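(* Let $\mathscr V$ be a variety of algebras having a weak difference term, and assume that $\mathscr V$ is not congruence meet semidistributive. Then there is a prime field $\mathbf P$ such that, for every finite $n$, the lattice of subspaces of a vector space over $\mathbf P$ of dimension $n$ lies in $\mathbf{S}\,\mathbf{Con}(\mathscr V)$.
   Context: For a variety $\mathscr V$, $\mathbf{Con}(\mathscr V)=\{\mathbf{Con}(\mathbf A):\mathbf A\in\mathscr V\}$ and $\mathbf S\,\mathbf{Con}(\mathscr V)$ is the class of all lattices isomorphic to a sublattice of $\mathbf{Con}(\mathbf A)$ for some $\mathbf A\in\mathscr V$. $\mathscr V$ is congruence meet semidistributive if every $\mathbf{Con}(\mathbf A)$, $\mathbf A\in\mathscr V$, satisfies $x\wedge y=x\wedge z\rightarrow x\wedge y=x\wedge(y\vee z)$. Commutator: for congruences $\alpha,\beta,\delta$ of $\mathbf A$, $\mathrm C(\alpha,\beta;\delta)$ means that for every term $t(\bar x,\bar y)$ and all tuples $\bar a,\bar b,\bar c,\bar d$ from $A$ with $a_i\mathrel\alpha b_i$ and $c_j\mathrel\beta d_j$ for all $i,j$: if $t(\bar a,\bar c)\mathrel\delta t(\bar a,\bar d)$ then $t(\bar b,\bar c)\mathrel\delta t(\bar b,\bar d)$. The commutator $[\alpha,\beta]$ is the least $\delta$ with $\mathrm C(\alpha,\beta;\delta)$. A term $d(x,y,z)$ is a weak difference term for $\mathbf A$ if for all $\theta\in\mathbf{Con}(\mathbf A)$ and all $\langle a,b\rangle\in\theta$, $a\mathrel{[\theta,\theta]}d(a,b,b)$ and $d(a,a,b)\mathrel{[\theta,\theta]}b$.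 A variety has a weak difference term if some term $d$ is a weak difference term for all of its members. A prime field is $\mathbb Q$ or $\mathbb Z/p\mathbb Z$, $p$ prime. *)

(* Defs.v *)
From HB Require Import structures.
From mathcomp Require Import all_boot all_order all_algebra.
From mathcomp Require Import boolp.
From Stdlib Require Import RelationClasses.

Set Implicit Arguments.
Unset Strict Implicit.
Unset Printing Implicit Defensive.

Import Order.TTheory GRing.Theory.

Record signature := Signature { op :> Type; arity : op -> nat }.

Record algebra (S : signature) := Algebra {
  carrier :> Type;
  interp : forall o : S, ('I_(arity o) -> carrier) -> carrier;
  carrier_inhabited : inhabited carrier
}.

Inductive term (S : signature) (X : Type) : Type :=
| Var of X
| App (o : S) of 'I_(arity o) -> term S X.

Fixpoint eval (S : signature) (A : algebra S) (X : Type) (v : X -> A)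
    (t : term S X) : A :=
  match t with
  | Var x => v x
  | App o ts => interp (fun i => eval v (ts i))
  end.

Definition satisfies (S : signature) (A : algebra S) (s t : term S nat) : Prop :=
  forall v : nat -> A, eval v s = eval v t.

(* A variety is the class of all models of some set of identities. *)
Definition variety (S : signature) (V : algebra S -> Prop) : Prop :=
  exists E : term S nat -> term S nat -> Prop,
    forall A : algebra S, V A <-> (forall s t, E s t -> satisfies A s t).

Record congruence (S : signature) (A : algebra S) := Congruence {
  cong_rel :> A -> A -> Prop;
  cong_equiv : Equivalence cong_rel;
  cong_compat : forall (o : S) (u v : 'I_(arity o) -> A),
    (forall i, cong_rel (u i) (v i)) -> cong_rel (interp u) (interp v)
}.

Fact cong_display : Order.disp_t. Proof. exact: Order.Disp tt tt. Qed.

Section CongruenceLattice.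
Variables (S : signature) (A : algebra S).
Implicit Types (a b g : congruence A) (F : congruence A -> Prop).

HB.instance Definition _ := gen_eqMixin (congruence A).
HB.instance Definition _ := gen_choiceMixin (congruence A).

Definition cong_sub a b : Prop := forall x y, a x y -> b x y.

Definition cong_inf_rel F (x y : A) : Prop := forall g, F g -> g x y.

Lemma cong_inf_equiv F : Equivalence (cong_inf_rel F).
Proof.
split.
- by move=> x g _; case: (cong_equiv g) => r _ _; apply: r.
- by move=> x y xy g Fg; case: (cong_equiv g) => _ s _; apply: s; apply: xy.
- move=> x y z xy yz g Fg; case: (cong_equiv g) => _ _ t.
  by apply: t (xy g Fg) (yz g Fg).
Qed.

Lemma cong_inf_compat F (o : S) (u v : 'I_(arity o) -> A) :
  (forall i, cong_inf_rel F (u i) (v i)) ->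
  cong_inf_rel F (interp u) (interp v).
Proof. by move=> uv g Fg; apply: cong_compat => i; apply: uv. Qed.

Definition cong_inf F : congruence A :=
  Congruence (cong_inf_equiv F) (@cong_inf_compat F).

Lemma cong_inf_lb F g : F g -> cong_sub (cong_inf F) g.
Proof. by move=> Fg x y; apply. Qed.

Lemma cong_inf_glb F a : (forall g, F g -> cong_sub a g) ->
  cong_sub a (cong_inf F).
Proof. by move=> aF x y axy g Fg; apply: aF. Qed.

Definition cong_meet a b := cong_inf (fun g => g = a \/ g = b).
Definition cong_join a b :=
  cong_inf (fun g => cong_sub a g /\ cong_sub b g).

Definition cong_le : rel (congruence A) := fun a b => `[< cong_sub a b >].

Lemma cong_le_refl : reflexive cong_le.
Proof. by move=> a; apply/asboolP. Qed.

Lemma cong_le_anti : antisymmetric cong_le.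
Proof.
move=> a b /andP[/asboolP ab /asboolP ba].
have eab : cong_rel a = cong_rel b.
  by apply/funext => x; apply/funext => y; apply/propext; split=> [/ab|/ba].
case: a b eab {ab ba} => ra ea ca [rb eb cb] /= eab.
by subst rb; congr Congruence; apply: Prop_irrelevance.
Qed.

Lemma cong_le_trans : transitive cong_le.
Proof.
by move=> b a g /asboolP ab /asboolP bg; apply/asboolP => x y /ab/bg.
Qed.

HB.instance Definition _ := Order.Le_isPOrder.Build cong_display
  (congruence A) cong_le_refl cong_le_anti cong_le_trans.

Lemma cong_meetP g a b :
  (g <= cong_meet a b)%O = (g <= a)%O && (g <= b)%O.
Proof.
apply/asboolP/andP => [h|[/asboolP ga /asboolP gb]].
  by split; apply/asboolP => x y /h; apply; [left|right].
by apply: cong_inf_glb => ? [->|->].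
Qed.

Lemma cong_joinP a b g :
  (cong_join a b <= g)%O = (a <= g)%O && (b <= g)%O.
Proof.
apply/asboolP/andP => [h|[/asboolP ag /asboolP bg]].
  by split; apply/asboolP => x y xy; apply: h => c [ac bc]; [apply: ac|apply: bc].
exact: cong_inf_lb.
Qed.

HB.instance Definition _ := Order.POrder_MeetJoin_isLattice.Build
  cong_display (congruence A) cong_meetP cong_joinP.

End CongruenceLattice.

Definition meet_semidistributive d (L : latticeType d) : Prop :=
  forall x y z : L,
    (x `&` y = x `&` z -> x `&` y = x `&` (y `|` z))%O.

Definition congruence_meet_semidistributive (S : signature)
    (V : algebra S -> Prop) : Prop :=
  forall A, V A -> meet_semidistributive (congruence A).

(* An injective lattice morphism is an isomorphism onto a sublattice; least and
   greatest elements need not be preserved. *)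
Definition in_SCon (S : signature) (V : algebra S -> Prop)
    d (L : latticeType d) : Prop :=
  exists2 A : algebra S, V A
    & exists f : {lmorphism L -> congruence A}, injective f.

(* [commutator a b] is defined as an intersection; [commutator_centralizes] and
   [commutator_least] show that it is the least d with C(a, b; d). *)
Section Commutator.
Variables (S : signature) (A : algebra S).
Implicit Types a b d : congruence A.

Definition sum_env (X Y : Type) (u : X -> A) (v : Y -> A) (z : X + Y) : A :=
  match z with inl x => u x | inr y => v y end.

Definition centralizes a b d : Prop :=
  forall (m n : nat) (t : term S ('I_m + 'I_n))
         (u u' : 'I_m -> A) (v v' : 'I_n -> A),
    (forall i, a (u i) (u' i)) -> (forall j, b (v j) (v' j)) ->
    d (eval (sum_env u v) t) (eval (sum_env u v') t) ->
    d (eval (sum_env u' v) t) (eval (sum_env u' v') t).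

Definition commutator a b : congruence A := cong_inf (centralizes a b).

Lemma commutator_centralizes a b : centralizes a b (commutator a b).
Proof.
move=> m n t u u' v v' auu bvv h d Cd.
by apply: (Cd m n t u u' v v') => //; apply: h.
Qed.

Lemma commutator_least a b d : centralizes a b d -> (commutator a b <= d)%O.
Proof. by move=> Cd; apply/asboolP; apply: cong_inf_lb. Qed.

Definition app3 (t : term S 'I_3) (x y z : A) : A :=
  eval (tnth [tuple x; y; z]) t.

Definition weak_difference_term_for (t : term S 'I_3) : Prop :=
  forall (th : congruence A) (x y : A), th x y ->
    commutator th th x (app3 t x y y) /\ commutator th th (app3 t x x y) y.

End Commutator.

Definition has_weak_difference_term (S : signature)
    (V : algebra S -> Prop) : Prop :=
  exists t : term S 'I_3, forall A, V A -> weak_difference_term_for A t.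

Inductive prime_field : fieldType -> Prop :=
| prime_field_rat : prime_field rat
| prime_field_Fp p : prime p -> prime_field 'F_p.

Fact vspace_display : Order.disp_t. Proof. exact: Order.Disp tt tt. Qed.

Section SubspaceLattice.
Variables (K : fieldType) (vT : vectType K).

Let subv_le : rel {vspace vT} := fun U W => (U <= W)%VS.

HB.instance Definition _ := Order.Le_isPOrder.Build vspace_display
  {vspace vT} (@subvv K vT : reflexive subv_le) (@subv_anti K vT)
  (@subv_trans K vT).

Let capvP (U W W' : {vspace vT}) :
  (U <= W :&: W')%VS = (U <= W)%VS && (U <= W')%VS.
Proof. exact: subv_cap. Qed.

Let addvP (U W W' : {vspace vT}) :
  (U + W <= W')%VS = (U <= W')%VS && (W <= W')%VS.
Proof. exact: subv_add. Qed.

HB.instance Definition _ := Order.POrder_MeetJoin_isLattice.Build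
  vspace_display {vspace vT} capvP addvP.

End SubspaceLattice.

(* Main.v *)
(* If x /\ y = x /\ z = de < th = x /\ (y \/ z), then y and z, hence th,
   centralize th modulo de, so the interval [de, th] is abelian. The weak
   difference term d then makes every th-block modulo de an abelian group (up to
   the choice of an origin) with d(x, y, z) = x - y + z, and the operations are
   affine maps between products of blocks. Hence linear conditions with integer
   coefficients on differences define congruences. If some block M has pM <> M
   for a prime p, replace de by de + p th; otherwise, if some block has
   p-torsion, replace th by its p-torsion part; otherwise all blocks are
   divisible and torsion-free. In each case the blocks become vector spaces over
   a prime field P, and the operations are affine over P. On the subalgebra of
   A^(1+n) of tuples lying in one block, a subspace U of P^n is sent to the
   congruence "x - y lies in U (x) M", where M is the block at hand; as M <> 0
   for some block, this is a lattice embedding. *)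
From HB Require Import structures.
Require Import Defs.
From mathcomp Require Import all_boot all_order all_algebra.
From mathcomp Require Import boolp.
From Stdlib Require Import RelationClasses.

Set Implicit Arguments.
Unset Strict Implicit.
Unset Printing Implicit Defensive.

Import Order.TTheory GRing.Theory Num.Theory.

(** * Terms, joins of congruences and the centralizer relation *)

Section UniversalAlgebra.
Variable S : signature.

Fixpoint subst (X Y : Type) (s : X -> term S Y) (t : term S X) : term S Y :=
  match t with
  | Var x => s x
  | App o ts => App (fun i => subst s (ts i))
  end.

Lemma eval_subst (A : algebra S) (X Y : Type) (v : Y -> A) (s : X -> term S Y)
    t : eval v (subst s t) = eval (fun x => eval v (s x)) t.
Proof. by elim: t => //= o ts IH; congr interp; apply/funext. Qed.

Variable A : algebra S.
Implicit Types (g a b th de : congruence A) (x y z : A).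

Lemma cong_refl g x : g x x. Proof. by case: (cong_equiv g). Qed.

Lemma cong_sym g x y : g x y -> g y x.
Proof. by case: (cong_equiv g) => _ + _; apply. Qed.

Lemma cong_trans g y x z : g x y -> g y z -> g x z.
Proof. by case: (cong_equiv g) => _ _; apply. Qed.

Hint Resolve cong_refl : core.

Lemma eval_cong g (X : Type) (v w : X -> A) t :
  (forall i, g (v i) (w i)) -> g (eval v t) (eval w t).
Proof. by move=> vw; elim: t => //= o ts IH; apply: cong_compat. Qed.

(** Renaming variables along [enum_rank] carries the term condition from ordinals to arbitrary
    finite index types, so that variables can be grouped by their role. *)
Lemma centralizes_fin a b g : centralizes a b g ->
  forall (X Y : finType) (t : term S (X + Y)) u u' v v',
    (forall i, a (u i) (u' i)) -> (forall j, b (v j) (v' j)) ->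
    g (eval (sum_env u v) t) (eval (sum_env u v') t) ->
    g (eval (sum_env u' v) t) (eval (sum_env u' v') t).
Proof.
move=> C X Y t u u' v v' uu vv.
pose s (z : X + Y) : term S ('I_#|X| + 'I_#|Y|) := Var S
  match z with inl x => inl (enum_rank x) | inr y => inr (enum_rank y) end.
have E w w' : eval (sum_env w w') t =
    eval (sum_env (w \o enum_val) (w' \o enum_val)) (subst s t).
  rewrite eval_subst; congr (eval _ t); apply/funext.
  by case=> z /=; rewrite enum_rankK.
by rewrite !E; apply: C => i /=.
Qed.

Section Join.
Variables a b : congruence A.

(** The transitive closure of [a] followed by [b], graded by length so that finitely many chains can
    be padded to a common length. *)
Fixpoint zigzag k x y : Prop :=
  if k is k'.+1 then exists z w, [/\ zigzag k' x z, a z w & b w y] else x = y.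

Lemma zigzag_leq k l x y : (k <= l)%N -> zigzag k x y -> zigzag l x y.
Proof.
move=> /subnK <-; elim: (l - k)%N => [//|m IH] /IH h.
by exists y, y; split.
Qed.

Lemma zigzag_trans k l x y z : zigzag k x y -> zigzag l y z ->
  zigzag (k + l)%N x z.
Proof.
move=> h; elim: l z => [|l IH] z /=; first by rewrite addn0 => <-.
by case=> u [w [/IH yu uw wz]]; rewrite addnS; exists u, w.
Qed.

Lemma zigzag_sym k x y : zigzag k x y -> exists l, zigzag l y x.
Proof.
elim: k x y => [|k IH] x y /=; first by move=> ->; exists 0%N.
case=> z [w [/IH [l lzx] zw wy]].
exists (1 + (1 + l))%N; apply: (@zigzag_trans 1 _ _ w).
  by exists y, y; split=> //; apply: cong_sym.
apply: zigzag_trans lzx; exists w, z; split=> //; exact: cong_sym.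
Qed.

Lemma zigzag_interp k (o : S) (u v : 'I_(arity o) -> A) :
  (forall i, zigzag k (u i) (v i)) -> zigzag k (interp u) (interp v).
Proof.
elim: k u v => [|k IH] u v h /=; first by congr interp; apply/funext.
have [z hz] := choice h; have [w hw] := choice hz.
exists (interp z), (interp w); split.
- by apply: IH => i; case: (hw i).
- by apply: cong_compat => i; case: (hw i).
- by apply: cong_compat => i; case: (hw i).
Qed.

Lemma zigzag_bound n (u v : 'I_n -> A) :
  (forall i, exists k, zigzag k (u i) (v i)) ->
  exists k, forall i, zigzag k (u i) (v i).
Proof.
move=> /choice [k hk]; exists (\max_i k i)%N => i.
by apply: zigzag_leq (hk i); apply: leq_bigmax.
Qed.

Lemma zigzag_equiv : Equivalence (fun x y => exists k, zigzag k x y).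
Proof.
split.
- by move=> x; exists 0%N.
- by move=> x y [k] /zigzag_sym.
- by move=> x y z [k xy] [l yz]; exists (k + l)%N; apply: zigzag_trans xy yz.
Qed.

Lemma zigzag_compat (o : S) (u v : 'I_(arity o) -> A) :
  (forall i, exists k, zigzag k (u i) (v i)) ->
  exists k, zigzag k (interp u) (interp v).
Proof. by move=> /zigzag_bound [k h]; exists k; apply: zigzag_interp. Qed.

Lemma join_zigzag x y : (a `|` b)%O x y -> exists k, zigzag k x y.
Proof.
have: (a `|` b <= Congruence zigzag_equiv zigzag_compat)%O.
  rewrite leUx; apply/andP; split; apply/asboolP => z w h; exists 1%N.
    by exists z, w.
  by exists z, z.
by move=> /asboolP h /h.
Qed.

(** Chains from [u i] to [u' i] can be given a common length because there are finitely many [i].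
    The term condition is then carried along one link at a time, each link lying in [a] or in
    [b]. *)
Lemma centralizes_join th de :
  centralizes a th de -> centralizes b th de -> centralizes (a `|` b)%O th de.
Proof.
move=> Ca Cb m n t u u' v v' uu vv h.
have [k hk] : exists k, forall i, zigzag k (u i) (u' i).
  by apply: zigzag_bound => i; apply: join_zigzag.
elim: k u' {uu} hk => [|k IH] u' hk.
  by have <- : u = u' by apply/funext.
have [z hz] := choice hk; have [w hw] := choice hz.
apply: (Cb _ _ _ w) => [i|//|]; first by case: (hw i).
apply: (Ca _ _ _ z) => [i|//|]; first by case: (hw i).
by apply: IH => i; case: (hw i).
Qed.

End Join.

Lemma meetE a b x y : (a `&` b)%O x y <-> a x y /\ b x y.
Proof.
have -> : (a `&` b)%O = cong_meet a b by [].
split=> [h|[ax bx] g [->|->] //].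
by split; apply: h; [left|right].
Qed.

Lemma cong_leP a b : reflect (forall x y, a x y -> b x y) (a <= b)%O.
Proof. exact: asboolP. Qed.

Lemma centralizes_mono a a' b b' g :
  (a' <= a)%O -> (b' <= b)%O -> centralizes a b g -> centralizes a' b' g.
Proof.
move=> /cong_leP aa /cong_leP bb C m n t u u' v v' uu vv.
by apply: C => i; [apply: aa|apply: bb].
Qed.

(** The two values at [u'] are congruent modulo [b] because [v] and [v'] are, and modulo [a] by a
    detour through the values at [u]; hence modulo the meet, which lies below [g]. *)
Lemma centralizes_of_meet a b g :
  (g <= a)%O -> (a `&` b <= g)%O -> centralizes a b g.
Proof.
move=> /cong_leP ga /cong_leP abg m n t u u' v v' uu vv h.
apply/abg/meetE; split.
  apply: (@cong_trans _ (eval (sum_env u v) t)).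
    by apply: eval_cong => -[i|j] //=; apply: cong_sym.
  apply: (@cong_trans _ (eval (sum_env u v') t)); first exact: ga.
  by apply: eval_cong => -[i|j] /=.
by apply: eval_cong => -[i|j] /=.
Qed.

Lemma not_meet_semidistributive :
  ~ meet_semidistributive (congruence A) ->
  exists th de : congruence A, [/\ (de <= th)%O, de != th & centralizes th th de].
Proof.
move=> /existsNP[a /existsNP[b /existsNP[c /not_implyP[e ne]]]].
pose th := (a `&` (b `|` c))%O; exists th, (a `&` b)%O; split.
- by rewrite leI2 ?leUl.
- exact/eqP.
- have tb : (th <= b `|` c)%O by rewrite leIr.
  (* Both [b] and [c] lie above the common meet with [a], and both meet [th] inside it because [th]
     is below [a]. *)
  apply: centralizes_mono tb (lexx th) _; apply: centralizes_join.
    apply: centralizes_of_meet; first exact: leIr.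
    by rewrite lexI leIl andbT (le_trans (leIr _ _)) // leIl.
  rewrite e; apply: centralizes_of_meet; first exact: leIr.
  by rewrite lexI leIl andbT (le_trans (leIr _ _)) // leIl.
Qed.

End UniversalAlgebra.

(** * The heap structure on the blocks of an abelian interval *)

Section Heap.
Variables (S : signature) (dt : term S 'I_3) (A : algebra S).
Implicit Types (g th de : congruence A) (x y z : A).

Hint Resolve cong_refl : core.

Let d := app3 (A := A) dt.

Lemma app3_cong g x x' y y' z z' :
  g x x' -> g y y' -> g z z' -> g (d x y z) (d x' y' z').
Proof. by move=> xx yy zz; apply: eval_cong; case=> -[|[|[|//]]]. Qed.

(* Modulo [de], the difference term makes each [th]-block an abelian heap
   [d x y z = x - y + z], and the basic operations are heap morphisms. *)
Record heap th de : Prop := Heap {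
  heap_le : (de <= th)%O;
  heap_r : forall x y, th x y -> de (d x y y) x;
  heap_l : forall x y, th x y -> de (d x x y) y;
  heap_interp : forall (o : S) (x y z : 'I_(arity o) -> A),
    (forall i, th (x i) (y i)) -> (forall i, th (y i) (z i)) ->
    de (interp (fun i => d (x i) (y i) (z i)))
       (d (interp x) (interp y) (interp z)) }.

Lemma heap_mono th de th' de' :
  (th' <= th)%O -> (de <= de')%O -> (de' <= th')%O -> heap th de -> heap th' de'.
Proof.
move=> /cong_leP tt /cong_leP dd dt' [_ hr hl hi]; split=> //.
- by move=> x y /tt /hr /dd.
- by move=> x y /tt /hl /dd.
- by move=> o x y z xy yz; apply/dd/hi => i; apply: tt.
Qed.

Definition app3_term X (a b c : term S X) : term S X :=
  subst (tnth [tuple a; b; c]) dt.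

Lemma eval_app3_term X (v : X -> A) a b c :
  eval v (app3_term a b c) = d (eval v a) (eval v b) (eval v c).
Proof.
rewrite eval_subst; congr (eval _ dt); apply/funext.
by case=> -[|[|[|//]]].
Qed.

Lemma abelian_heap th de : (de <= th)%O -> centralizes th th de ->
  weak_difference_term_for A dt -> heap th de.
Proof.
(* The commutator of [th] with itself is below [de], so the weak difference equations hold modulo
   [de]. *)
move=> le C W; have [lex /cong_leP cd] := (cong_leP _ _ le, commutator_least C).
have hr x y : th x y -> de (d x y y) x.
  by move=> /W [h _]; apply/cong_sym/cd.
have hl x y : th x y -> de (d x x y) y by move=> /W [_ h]; apply: cd.
split=> // o x y z xy yz; set r := arity o in x y z xy yz *.
have xz i : th (x i) (z i) by apply: cong_trans (yz i).
have fyx : th (interp y) (interp x) by apply: cong_compat => i; apply: cong_sym.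
have fyz : th (interp y) (interp z) by apply: cong_compat.
have fxy := cong_sym fyx; have fxz := cong_trans fxy fyz.
(* The left variables hold [x], [y] and the parameter [G], the right ones hold [z]. In the term
   condition the [x]-slots move from [y] to [x] and the [z]-slots from [z] to [y]. *)
pose X : finType := ('I_r + 'I_r + unit)%type.
pose vx i : term S (X + 'I_r) := Var S (inl (inl (inl i))).
pose vy i : term S (X + 'I_r) := Var S (inl (inl (inr i))).
pose ve : term S (X + 'I_r) := Var S (inl (inr tt)).
pose vz i : term S (X + 'I_r) := Var S (inr i).
(* As a function of [(x, z)], [d F G G], where [F] and [G] are the two sides of
   the interchange law, is constant mod [de] as soon as [x] or [z] equals [y];
   the term condition extends this to all [x] and [z]. *)
pose t := app3_term (App (fun i => app3_term (vx i) (vy i) (vz i)))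
  (app3_term (App vx) (App vy) (App vz)) ve.
set F := interp (fun i => d _ _ _); set G := d (interp x) _ _.
pose u a : X -> A := sum_env (sum_env a y) (fun=> G).
have tE a c : eval (sum_env (u a) c) t =
    d (interp (fun i => d (a i) (y i) (c i)))
      (d (interp a) (interp y) (interp c)) G.
  by rewrite eval_app3_term /=; congr d; rewrite ?eval_app3_term //=;
    congr interp; apply/funext => i; rewrite eval_app3_term.
have xG : th (interp x) G.
  apply: (cong_trans (y := d (interp x) (interp x) (interp x))).
    by apply/cong_sym/lex/hr.
  exact: app3_cong.
have xF : th (interp x) F.
  apply: cong_compat => i; apply: (cong_trans (y := d (x i) (x i) (x i))).
    by apply/cong_sym/lex/hr.
  exact: app3_cong.
have key a b c : th b G -> de a b -> de c b -> de (d a c G) G.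
  move=> bG ab cb; apply: cong_trans (hl _ _ bG); exact: app3_cong.
have hu i : th (u y i) (u x i) by case: i => [[i|i]|i] //=; apply: cong_sym.
have hv i : th (z i) (y i) by apply: cong_sym.
have h : de (d F G G) G.
  have := centralizes_fin C (t := t) hu hv; rewrite !tE => h.
  apply: cong_trans (h _) _.
  - apply: (cong_trans (y := G)); last apply: cong_sym.
      apply: (key _ (interp z)) => [||]; last exact: hl.
        exact: cong_trans (cong_sym fxz) xG.
      by apply: cong_compat => i; apply: hl.
    apply: (key _ (interp y)) => [||]; last exact: hl.
      exact: cong_trans fyx xG.
    by apply: cong_compat => i; apply: hl.
  - apply: (key _ (interp x)) => [//||]; last exact: hr.
    by apply: cong_compat => i; apply: hr.
apply: cong_trans h; apply/cong_sym/hr; exact: cong_trans (cong_sym xF) xG.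
Qed.

Section HeapLaws.
Variables th de : congruence A.
Hypothesis H : heap th de.

Let le x y : de x y -> th x y.
Proof. by move: x y; apply/cong_leP; case: H. Qed.

Lemma heap_closed o x y z : th o x -> th o y -> th o z -> th o (d x y z).
Proof.
move=> ox oy oz; apply: (cong_trans (y := d o o o)).
  by apply/cong_sym/le/(heap_r H).
exact: app3_cong.
Qed.

Lemma heap_eval X (t : term S X) (x y z : X -> A) :
  (forall i, th (x i) (y i)) -> (forall i, th (y i) (z i)) ->
  de (eval (fun i => d (x i) (y i) (z i)) t) (d (eval x t) (eval y t) (eval z t)).
Proof.
move=> xy yz; elim: t => [//|o ts IH] /=.
apply: (cong_trans (cong_compat IH)).
by apply: (heap_interp H) => i; apply: eval_cong.
Qed.

(** The symbol [d] is itself given by a term, so [heap_eval] makes it commute with itself. The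
    abelian group laws all come from this. *)
Lemma heap_interchange o (x y z : 'I_3 -> A) :
  (forall i, th o (x i)) -> (forall i, th o (y i)) -> (forall i, th o (z i)) ->
  let dr (u : 'I_3 -> A) := d (u (inord 0)) (u (inord 1)) (u (inord 2)) in
  de (dr (fun i => d (x i) (y i) (z i))) (d (dr x) (dr y) (dr z)).
Proof.
move=> ox oy oz dr.
have E u : dr u = eval u dt.
  rewrite /dr /d /app3; congr (eval _ dt); apply/funext => i.
  rewrite (tnth_nth (u i)); case: i => -[|[|[|//]]] h /=; congr (u _);
  by apply/val_inj; rewrite /= inordK.
rewrite !E; apply: heap_eval => i.
  exact: cong_trans (cong_sym (ox i)) (oy i).
exact: cong_trans (cong_sym (oy i)) (oz i).
Qed.

Lemma heap_medial o a1 a2 a3 b1 b2 b3 c1 c2 c3 :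
  th o a1 -> th o a2 -> th o a3 -> th o b1 -> th o b2 -> th o b3 ->
  th o c1 -> th o c2 -> th o c3 ->
  de (d (d a1 b1 c1) (d a2 b2 c2) (d a3 b3 c3))
     (d (d a1 a2 a3) (d b1 b2 b3) (d c1 c2 c3)).
Proof.
move=> ? ? ? ? ? ? ? ? ?.
have := @heap_interchange o (tnth [tuple a1; a2; a3])
  (tnth [tuple b1; b2; b3]) (tnth [tuple c1; c2; c3]).
rewrite /= !(tnth_nth a1) !inordK //=; apply; by case=> -[|[|[|//]]].
Qed.

End HeapLaws.

End Heap.

Local Open Scope ring_scope.

(** * Modules and primitive positive relations *)

Section DependentProduct.
Variables (R : nzRingType) (I : Type) (M : I -> lmodType R).

(** The arguments of one operation lie in different blocks, each with its own module; this is the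
    module of all argument tuples. *)
Definition dprod := forall i, M i.

HB.instance Definition _ := gen_eqMixin dprod.
HB.instance Definition _ := gen_choiceMixin dprod.

Lemma dprod_ext (u v : dprod) : (forall i, u i = v i) -> u = v.
Proof. exact: functional_extensionality_dep. Qed.

Let zero : dprod := fun=> 0.
Let add (u v : dprod) : dprod := fun i => u i + v i.
Let opp (u : dprod) : dprod := fun i => - u i.
Let scale (c : R) (u : dprod) : dprod := fun i => c *: u i.

Let addA : associative add.
Proof. by move=> u v w; apply: dprod_ext => i; apply: addrA. Qed.
Let addC : commutative add.
Proof. by move=> u v; apply: dprod_ext => i; apply: addrC. Qed.
Let add0 : left_id zero add.
Proof. by move=> u; apply: dprod_ext => i; apply: add0r. Qed.
Let addN : left_inverse zero opp add.
Proof. by move=> u; apply: dprod_ext => i; apply: addNr. Qed.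

HB.instance Definition _ := GRing.isZmodule.Build dprod addA addC add0 addN.

Let scaleA a b u : scale a (scale b u) = scale (a * b) u.
Proof. by apply: dprod_ext => i; apply: scalerA. Qed.
Let scale1 : left_id 1 scale.
Proof. by move=> u; apply: dprod_ext => i; apply: scale1r. Qed.
Let scaleDr : right_distributive scale +%R.
Proof. by move=> c u v; apply: dprod_ext => i; apply: scalerDr. Qed.
Let scaleDl u : {morph scale^~ u : a b / a + b}.
Proof. by move=> a b; apply: dprod_ext => i; apply: scalerDl. Qed.

HB.instance Definition _ :=
  GRing.Zmodule_isLmodule.Build R dprod scaleA scale1 scaleDr scaleDl.

Lemma dprod_sum (J : finType) (F : J -> dprod) i :
  (\sum_j F j) i = \sum_j F j i.
Proof. by apply: (big_morph (fun u : dprod => u i)). Qed.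

End DependentProduct.

(** Holds for the integers and for prime fields. It makes the affine maps between blocks linear over
    [R] although the scalars were chosen block by block. *)
Definition additive_is_linear (R : nzRingType) : Prop :=
  forall (M N : lmodType R) (f : M -> N),
    {morph f : x y / x + y} -> scalable f.

(** Since [f] is constant on the fibres of [pi] and both respect [d], [f] factors through [pi] by an
    affine map, and [L] is its linear part. [D] will be a block or a product of blocks. *)
Lemma affine_factor (R : nzRingType) (T : Type) (D : T -> Prop)
    (d : T -> T -> T -> T) (M N : lmodType R) (pi : T -> M) (f : T -> N) :
  additive_is_linear R ->
  (forall x y z, D x -> D y -> D z -> D (d x y z)) ->
  (forall m, exists2 x, D x & pi x = m) ->
  (forall x y z, D x -> D y -> D z -> pi (d x y z) = pi x - pi y + pi z) ->
  (forall x y z, D x -> D y -> D z -> f (d x y z) = f x - f y + f z) ->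
  (forall x y, D x -> D y -> pi x = pi y -> f x = f y) ->
  exists L : {linear M -> N},
    forall x y, D x -> D y -> f x - f y = L (pi x - pi y).
Proof.
move=> autR dD surj pid fd fpi.
have [s sD spi] : exists2 s : M -> T, forall m, D (s m) & forall m, pi (s m) = m.
  have [s hs] : exists s, forall m, D (s m) /\ pi (s m) = m.
    have h m : exists x, D x /\ pi x = m by have [x] := surj m; exists x.
    by have [s hs] := choice h; exists s.
  by exists s => m; have [] := hs m.
pose o := s 0; have oD : D o by apply: sD.
pose L m := f (s m) - f o.
have LE x y : D x -> D y -> f x - f y = L (pi x - pi y).
  (* As [pi o] is 0, the heap operation with [o] at the end represents subtraction. *)
  move=> Dx Dy; have E : pi (s (pi x - pi y)) = pi (d x y o).
    by rewrite pid // !spi addr0.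
  by rewrite /L (fpi _ _ (sD _) (dD _ _ _ Dx Dy oD) E) fd // addrK.
have Ladd : {morph L : m n / m + n}.
  move=> m n; have E : pi (s (m + n)) = pi (d (s m) o (s n)).
    by rewrite pid // !spi subr0.
  by rewrite {1}/L (fpi _ _ (sD _) (dD _ _ _ (sD m) oD (sD n)) E) fd // /L addrA.
have Llin : linear L by move=> a m n; rewrite Ladd autR.
pose L' : {linear M -> N} := HB.pack L (GRing.isLinear.Build R M N *:%R L Llin).
by exists L'.
Qed.

(* The primitive positive condition [exists w, v K = w B] on [v] in [M ^ n]. *)
Definition pp (R : nzRingType) (n l m : nat) (K : 'M[R]_(n, l))
    (B : 'M[R]_(m, l)) (M : lmodType R) (v : 'I_n -> M) : Prop :=
  exists w : 'I_m -> M,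
    forall j, \sum_i K i j *: v i = \sum_k B k j *: w k.

Section PP.
Variables (R : nzRingType) (n l m : nat) (K : 'M[R]_(n, l)) (B : 'M[R]_(m, l)).

Lemma pp_linear (M N : lmodType R) (L : {linear M -> N}) v :
  pp K B v -> pp K B (L \o v).
Proof.
case=> w h; exists (L \o w) => j /=.
under eq_bigr do rewrite -linearZ; rewrite -linear_sum h linear_sum.
by apply: eq_bigr => k _; rewrite linearZ.
Qed.

Lemma pp0 (M : lmodType R) : pp K B (fun=> 0 : M).
Proof. by exists (fun=> 0) => j; rewrite !big1 // => i _; rewrite scaler0. Qed.

Lemma ppN (M : lmodType R) (v : 'I_n -> M) : pp K B v -> pp K B (\- v).
Proof.
case=> w h; exists (\- w) => j.
under eq_bigr do rewrite scalerN; rewrite sumrN h -sumrN.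
by apply: eq_bigr => k _; rewrite scalerN.
Qed.

Lemma ppD (M : lmodType R) (u v : 'I_n -> M) :
  pp K B u -> pp K B v -> pp K B (u \+ v).
Proof.
move=> [w h] [w' h']; exists (w \+ w') => j.
under eq_bigr do rewrite scalerDr; rewrite big_split /= h h' -big_split /=.
by apply: eq_bigr => k _; rewrite scalerDr.
Qed.

Lemma pp_dprod (I : Type) (M : I -> lmodType R) (v : 'I_n -> dprod M) :
  (forall s, pp K B (fun i => v i s)) -> pp K B v.
Proof.
move=> h.
have w s := cid (h s).
exists (fun k s => sval (w s) k) => j; apply: dprod_ext => s.
rewrite !dprod_sum; exact: (svalP (w s) j).
Qed.

End PP.

(** * Charts of blocks *)

Section Chart.
Variables (S : signature) (dt : term S 'I_3) (A : algebra S).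
Implicit Types (g th de : congruence A) (o x y z : A).

Hint Resolve cong_refl : core.

Let d := app3 (A := A) dt.

(* An affine isomorphism from the [th]-block of [o], modulo [de], onto [M]. *)
Record chart th de o (M : zmodType) (pi : A -> M) : Prop := Chart {
  chart_surj : forall m, exists2 x, th o x & pi x = m;
  chart_eq : forall x y, th o x -> th o y -> pi x = pi y <-> de x y;
  chart_affine : forall x y z, th o x -> th o y -> th o z ->
    pi (d x y z) = pi x - pi y + pi z }.

Definition has_charts (R : nzRingType) th de : Prop :=
  forall o, exists (M : lmodType R) (pi : A -> M), chart th de o pi.

(** The group consists of the [de]-classes in the block of [o], with [o] as zero, [d m o n] as sum
    and [d o m o] as opposite. *)
Lemma chart_exists th de o : heap dt th de ->
  exists (M : zmodType) (pi : A -> M), chart th de o pi.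
Proof.
move=> H; have /cong_leP le := heap_le H.
have cl x y z : th o x -> th o y -> th o z -> th o (d x y z).
  exact: (heap_closed H).
have oo : th o o by [].
have xy_th x y : th o x -> th o y -> th x y.
  by move=> /cong_sym; apply: cong_trans.
pose blk (Q : A -> Prop) := exists2 x, th o x & Q = de x.
pose T := {Q : A -> Prop | blk Q}.
have sext (m n : T) : sval m = sval n -> m = n.
  by case: m n => [a p] [b q] /= e; apply: eq_exist.
have [pi [surj pieq]] : exists pi : A -> T, (forall m, exists2 x, th o x & pi x = m)
    /\ forall x y, th o x -> th o y -> pi x = pi y <-> de x y.
  (* Points outside the block get the class of [o] as a default value. *)
  have b x : exists m : T, th o x -> sval m = de x.
    have [ox|nox] := pselect (th o x).
      by have bx : blk (de x) by [exists x]; exists (exist _ _ bx).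
    by have bo : blk (de o) by [exists o]; exists (exist _ _ bo).
  have [pi piE] := choice b; exists pi; split=> [[Q [x ox e]]|x y ox oy].
    by exists x => //; apply: sext; rewrite piE.
  split=> [/(congr1 sval)|xy].
    by rewrite !piE // => e; rewrite e.
  apply: sext; rewrite !piE //; apply/funext => z; apply/propext.
  split; first by apply/cong_trans/cong_sym.
  exact: cong_trans.
have pid x y : th o x -> th o y -> de x y -> pi x = pi y.
  by move=> ox oy /pieq; apply.
have [r ro rK] : exists2 r : T -> A, forall m, th o (r m) & forall m, pi (r m) = m.
  have h m : exists x, th o x /\ pi x = m by have [x] := surj m; exists x.
  by have [r hr] := choice h; exists r => m; have [] := hr m.
have rpi x : th o x -> de (r (pi x)) x by move=> ox; apply/pieq.
pose zero := pi o.
pose add m n := pi (d (r m) o (r n)).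
pose opp m := pi (d o (r m) o).
have addE x y : th o x -> th o y -> add (pi x) (pi y) = pi (d x o y).
  by move=> ox oy; apply: pid; try (apply: cl => //); apply: app3_cong => //; apply: rpi.
have oppE x : th o x -> opp (pi x) = pi (d o x o).
  by move=> ox; apply: pid; try (apply: cl => //); apply: app3_cong => //; apply: rpi.
have dr x y : th o x -> th o y -> de (d x y y) x.
  by move=> ox oy; apply: (heap_r H); apply: xy_th.
have dl x y : th o x -> th o y -> de (d x x y) y.
  by move=> ox oy; apply: (heap_l H); apply: xy_th.
have med := heap_medial H (o := o).
(* The entries are padded with copies of [y] to a 3 by 3 array, and the medial law transposes it.
   The same device gives [dA]. *)
have dC x y z : th o x -> th o y -> th o z -> de (d x y z) (d z y x).
  move=> ox oy oz.
  apply: (cong_trans (y := d (d y y x) (d y y y) (d z y y))).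
    by apply/cong_sym/app3_cong; [apply: dl|apply: dl|apply: dr].
  apply: cong_trans (med _ _ _ _ _ _ _ _ _ _ _ _ _ _ _ _ _ _) _ => //.
  by apply: app3_cong; [apply: dl|apply: dl|apply: dr].
have dA x y z u v : th o x -> th o y -> th o z -> th o u -> th o v ->
    de (d (d x y z) u v) (d x y (d z u v)).
  move=> ox oy oz ou ov.
  apply: (cong_trans (y := d (d x y z) (d y y u) (d y y v))).
    by apply/cong_sym/app3_cong => //; apply: dl.
  apply: cong_trans (med _ _ _ _ _ _ _ _ _ _ _ _ _ _ _ _ _ _) _ => //.
  by apply: app3_cong => //; apply: dr.
have addA : associative add.
  move=> m n p; have [x ox <-] := surj m; have [y oy <-] := surj n.
  have [z oz <-] := surj p; rewrite !addE //; try exact: cl.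
  by apply: pid; [do !apply/cl|do !apply/cl|
    apply/cong_sym/dA].
have addC : commutative add.
  move=> m n; have [x ox <-] := surj m; have [y oy <-] := surj n.
  by rewrite !addE //; apply: pid; [apply: cl|apply: cl|apply: dC].
have add0 : left_id zero add.
  move=> m; have [x ox <-] := surj m.
  by rewrite addE //; apply: pid; [apply: cl| |apply: dl].
have subE x y : th o x -> th o y -> add (pi x) (opp (pi y)) = pi (d x y o).
  move=> ox oy; rewrite oppE // addE //; last exact: cl.
  apply: pid; [by do !apply/cl|exact: cl|].
  apply: cong_trans (cong_sym (dA _ _ _ _ _ _ _ _ _ _)) _ => //.
  by apply: app3_cong => //; apply: dr.
have addN : left_inverse zero opp add.
  move=> m; have [x ox <-] := surj m.
  by rewrite addC subE //; apply: pid; [apply: cl| |apply: dl].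
pose Tc : choiceType := HB.pack T (gen_eqMixin T) (gen_choiceMixin T).
pose M : zmodType := HB.pack T Tc (GRing.isZmodule.Build Tc addA addC add0 addN).
exists M, pi; split=> // x y z ox oy oz.
change (pi (d x y z) = add (add (pi x) (opp (pi y))) (pi z)).
rewrite subE // addE //; last exact: cl.
apply: pid; [exact: cl|by do !apply/cl|].
apply: cong_trans (cong_sym (dA _ _ _ _ _ _ _ _ _ _)) => //.
by apply: app3_cong => //; apply/cong_sym/dl.
Qed.

Section Factor.
Variable R : nzRingType.
Hypothesis autR : additive_is_linear R.

(** The identity of [A] induces an affine map from a block modulo [de] to a block modulo [de']. This
    covers changes of chart or origin, quotients of blocks and inclusions of smaller blocks. *)
Lemma chart_factor th de th' de' o o' (M N : lmodType R) (pi : A -> M)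
    (rho : A -> N) :
  heap dt th de -> (th <= th')%O -> (de <= de')%O -> th' o' o ->
  chart th de o pi -> chart th' de' o' rho ->
  exists L : {linear M -> N}, forall x y,
    th o x -> th o y -> rho x - rho y = L (pi x - pi y).
Proof.
move=> H /cong_leP le /cong_leP ld oo cM cN.
have ext x : th o x -> th' o' x by move=> /le; apply: cong_trans.
apply: (affine_factor (d := d) autR) => [x y z|m|x y z|x y z ox oy oz|x y ox oy].
- exact: (heap_closed H).
- exact: (chart_surj cM).
- exact: (chart_affine cM).
- by apply: (chart_affine cN); apply: ext.
- by move=> e; apply/(chart_eq cN (ext _ ox) (ext _ oy))/ld/(chart_eq cM ox oy).
Qed.

End Factor.

End Chart.

(** * Compatibility of primitive positive relations with the operations *)

Section PPRelation.
Variables (S : signature) (dt : term S 'I_3) (A : algebra S).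
Variables (th de : congruence A) (R : nzRingType).
Hypotheses (H : heap dt th de) (autR : additive_is_linear R).
Hypothesis charts : has_charts dt R th de.
Variables (n l m : nat) (K : 'M[R]_(n, l)) (B : 'M[R]_(m, l)).
Implicit Types (o : A) (x y z : 'I_n -> A).

Hint Resolve cong_refl : core.

(** One chart suffices, since by [pp_rel_chart] the condition then holds in all charts of the block.
    One coordinate yields congruences of [A], several yield congruences of a power. *)
Definition pp_rel o x y : Prop := exists (M : lmodType R) (pi : A -> M),
  [/\ chart dt th de o pi, forall i, th o (x i), forall i, th o (y i)
    & pp K B (fun i => pi (x i) - pi (y i))].

Lemma pp_rel_chart o o' x y (N : lmodType R) (rho : A -> N) :
  pp_rel o x y -> th o o' -> chart dt th de o' rho ->
  pp K B (fun i => rho (x i) - rho (y i)).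
Proof.
move=> [M [pi [cM ox oy h]]] oo cN.
have [L LE] := chart_factor autR H (lexx th) (lexx de) (cong_sym oo) cM cN.
have -> : (fun i => rho (x i) - rho (y i)) = L \o (fun i => pi (x i) - pi (y i)).
  by apply/funext => i; rewrite LE.
exact: pp_linear.
Qed.

Lemma pp_rel_base o o' x y : th o o' -> pp_rel o x y -> pp_rel o' x y.
Proof.
move=> oo h; have [M [pi c]] := charts o'; have oo' := cong_sym oo.
exists M, pi; split=> //.
- by move: h => [? [? [_ ox _ _]]] i; apply: cong_trans (ox i).
- by move: h => [? [? [_ _ oy _]]] i; apply: cong_trans (oy i).
exact: pp_rel_chart h oo c.
Qed.

Lemma pp_rel_refl o x : (forall i, th o (x i)) -> pp_rel o x x.
Proof.
move=> ox; have [M [pi c]] := charts o; exists M, pi; split=> //.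
have -> : (fun i => pi (x i) - pi (x i)) = fun=> 0.
  by apply/funext => i; rewrite subrr.
exact: pp0.
Qed.

Lemma pp_rel_sym o x y : pp_rel o x y -> pp_rel o y x.
Proof.
move=> [M [pi [c ox oy /ppN h]]]; exists M, pi; split=> //.
have -> // : (fun i => pi (y i) - pi (x i)) = \- (fun i => pi (x i) - pi (y i)).
by apply/funext => i /=; rewrite opprB.
Qed.

Lemma pp_rel_trans o x y z : pp_rel o x y -> pp_rel o y z -> pp_rel o x z.
Proof.
move=> h [M [pi [c oy oz h']]]; exists M, pi; split=> //.
  by case: h => [? [? []]].
have := ppD (pp_rel_chart h (cong_refl th o) c) h'.
congr pp; apply/funext => i /=; by rewrite addrA subrK.
Qed.

(** The operation is an affine map from the product of the argument blocks to the block of the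
    value. Its linear part preserves primitive positive conditions, and these hold in a product once
    they hold in each factor. *)
Lemma pp_rel_interp (f : S) (o : 'I_(arity f) -> A)
    (x y : 'I_(arity f) -> 'I_n -> A) :
  (forall s, pp_rel (o s) (x s) (y s)) ->
  pp_rel (interp o) (fun i => interp (x^~ i)) (fun i => interp (y^~ i)).
Proof.
move=> h; have [N [rho cN]] := charts (interp o).
have {h} M s := cid (h s); have pi s := cid (svalP (M s)).
pose M' s := sval (M s); pose pi' s : A -> M' s := sval (pi s).
have hpi s : [/\ chart dt th de (o s) (pi' s), forall i, th (o s) (x s i),
    forall i, th (o s) (y s i) & pp K B (fun i => pi' s (x s i) - pi' s (y s i))].
  exact: svalP (pi s).
pose D (u : 'I_(arity f) -> A) := forall s, th (o s) (u s).
pose d (u v w : 'I_(arity f) -> A) s := app3 dt (u s) (v s) (w s).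
pose ppi (u : 'I_(arity f) -> A) : dprod M' := fun s => pi' s (u s).
have cM s : chart dt th de (o s) (pi' s) by case: (hpi s).
have Dd u v w : D u -> D v -> D w -> D (d u v w).
  by move=> Du Dv Dw s; apply: (heap_closed H).
have Df u : D u -> th (interp o) (interp u) by apply: cong_compat.
have DD u v s : D u -> D v -> th (u s) (v s).
  by move=> Du Dv; apply: cong_trans (cong_sym (Du s)) (Dv s).
have [||||L LE] := @affine_factor R _ D d (dprod M') N ppi (rho \o @interp S A f)
    autR Dd.
- move=> w; have [u hu] : exists u, forall s, th (o s) (u s) /\ pi' s (u s) = w s.
    have hw s : exists a, th (o s) a /\ pi' s a = w s.
      by have [a] := chart_surj (cM s) (w s); exists a.
    by have [u hu] := choice hw; exists u.
  exists u => [s|]; first by have [] := hu s.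
  by apply: dprod_ext => s; have [] := hu s.
- by move=> u v w Du Dv Dw; apply: dprod_ext => s; apply: (chart_affine (cM s)).
- move=> u v w Du Dv Dw /=.
  rewrite -(chart_affine cN (Df _ Du) (Df _ Dv) (Df _ Dw)).
  apply/(chart_eq cN); [exact/Df/Dd|by apply: (heap_closed H); apply: Df|].
  by apply: (heap_interp H) => s; apply: DD.
- move=> u v Du Dv e /=; apply/(chart_eq cN); [exact: Df|exact: Df|].
  apply: cong_compat => s; apply/(chart_eq (cM s) (Du s) (Dv s)).
  exact: (congr1 (fun w : dprod M' => w s) e).
have Dx i : D (x^~ i) by move=> s; case: (hpi s).
have Dy i : D (y^~ i) by move=> s; case: (hpi s).
exists N, rho; split=> // [i|i|]; [exact: Df|exact: Df|].
have -> : (fun i => rho (interp (x^~ i)) - rho (interp (y^~ i))) =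
    L \o (fun i => ppi (x^~ i) - ppi (y^~ i)).
  by apply/funext => i; rewrite /= -LE.
by apply: pp_linear; apply: pp_dprod => s; case: (hpi s).
Qed.

End PPRelation.

Section PPCongruence.
Variables (S : signature) (dt : term S 'I_3) (A : algebra S).
Variables (th de : congruence A) (R : nzRingType).
Hypotheses (H : heap dt th de) (autR : additive_is_linear R).
Hypothesis charts : has_charts dt R th de.
Variables (l m : nat) (K : 'M[R]_(1, l)) (B : 'M[R]_(m, l)).

Lemma pp_congruence : exists g : congruence A, forall x y, g x y <->
  pp_rel dt th de K B x (fun=> x) (fun=> y).
Proof.
pose r x y := pp_rel dt th de K B x (fun=> x) (fun=> y).
have rth x y : r x y -> th x y by move=> [? [? [_ _ /(_ ord0)]]].
have eqr : Equivalence r.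
  split=> [x|x y xy|x y z xy yz].
  - by apply: pp_rel_refl => // _; apply: cong_refl.
  - by apply/pp_rel_sym/(pp_rel_base H autR charts (rth _ _ xy)).
  - apply: pp_rel_trans (xy) _ => //.
    exact/(pp_rel_base H autR charts (cong_sym (rth _ _ xy))).
have cr (o : S) (u v : 'I_(arity o) -> A) : (forall i, r (u i) (v i)) ->
    r (interp u) (interp v).
  exact: (pp_rel_interp H autR charts (x := fun s=> fun=> u s) (y := fun s=> fun=> v s)).
by exists (Congruence eqr cr).
Qed.

End PPCongruence.

(** * Prime fields *)

(** Here [phi] is the identity; stating an isomorphism avoids an equation between bundled
    structures. *)
Lemma scaling_lmod (R : nzRingType) (M : zmodType) (s : R -> M -> M) :
  (forall a b v, s a (s b v) = s (a * b) v) -> left_id 1 s ->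
  right_distributive s +%R -> (forall v, {morph s^~ v : a b / a + b}) ->
  exists (N : lmodType R) (phi : M -> N),
    [/\ injective phi, forall v, exists u, phi u = v
      & {morph phi : u v / u + v}].
Proof.
case: M s => T cT s sA s1 sDr sDl.
pose N : lmodType R := HB.pack T (GRing.Zmodule.Pack cT)
  (GRing.Zmodule_isLmodule.Build R (GRing.Zmodule.Pack cT) sA s1 sDr sDl).
by exists N, (fun u => u); split=> // v; exists v.
Qed.

Section PrimeField.

Lemma int_additive_is_linear : additive_is_linear int.
Proof.
move=> M N f fD; have f0 : f 0 = 0 by apply: (addrI (f 0)); rewrite -fD !addr0.
have fN u : f (- u) = - f u by apply: (addrI (f u)); rewrite -fD !subrr.
have fn u n : f (u *+ n) = f u *+ n.
  by elim: n => [|n IH]; rewrite ?mulr0n // !mulrS fD IH.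
move=> a u; rewrite -(intz a) !scaler_int.
by case: a => n; rewrite ?NegzE ?mulrNz -!pmulrn ?fN fn.
Qed.

Variable P : fieldType.
Hypothesis primeP : prime_field P.

(** Writing every scalar as a fraction of integers treats both kinds of prime field at once; over
    ['F_p] the denominator is 1. *)
Lemma prime_field_fraction (c : P) :
  exists (a : int) (b : nat), b%:R != 0 :> P /\ b%:R * c = a%:~R.
Proof.
case: P / primeP c => [|p pp] c.
  exists (numq c), `|denq c|%N; rewrite pmulrn absz_denq.
  by rewrite intr_eq0 denq_eq0 mulrC numqE.
by exists (c : nat)%:Z, 1%N; rewrite oner_eq0 mul1r -pmulrn natr_Zp.
Qed.

Lemma prime_field_additive_is_linear : additive_is_linear P.
Proof.
move=> M N f fD c u; have [a [b [b0 e]]] := prime_field_fraction c.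
have f0 : f 0 = 0 by apply: (addrI (f 0)); rewrite -fD !addr0.
have fN v : f (- v) = - f v by apply: (addrI (f v)); rewrite -fD !subrr.
have fn v n : f (v *+ n) = f v *+ n.
  by elim: n => [|n IH]; rewrite ?mulr0n // !mulrS fD IH.
have fz v z : f (v *~ z) = f v *~ z.
  by case: z => n; rewrite ?NegzE ?mulrNz -!pmulrn ?fN fn.
apply: (can_inj (scalerK b0)); rewrite scaler_nat -fn -scaler_nat !scalerA e.
by rewrite !scaler_int fz.
Qed.

(** For [c] equal to [a / b], the multiple of [u] by [c] is the solution [w] of [w *+ b = u *~ a].
    It exists by divisibility and is unique by injectivity; the first hypothesis makes it
    independent of the fraction. *)
Lemma prime_field_lmod (M : zmodType) :
  (forall b : nat, b%:R = 0 :> P -> forall u : M, u *+ b = 0) ->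
  (forall b : nat, b%:R != 0 :> P -> forall v : M, exists u, u *+ b = v) ->
  (forall b : nat, b%:R != 0 :> P -> injective (fun u : M => u *+ b)) ->
  exists (N : lmodType P) (phi : M -> N),
    [/\ injective phi, forall v, exists u, phi u = v
      & {morph phi : u v / u + v}].
Proof.
move=> kill div inj.
have killz (a : int) (u : M) : a%:~R = 0 :> P -> u *~ a = 0.
  case: a => n; first by rewrite -!pmulrn => /kill.
  by rewrite NegzE !mulrNz => /eqP; rewrite oppr_eq0 -!pmulrn => /eqP/kill->;
    rewrite oppr0.
have ex (cu : P * M) : exists w, forall (a : int) (b : nat),
    b%:R != 0 :> P -> b%:R * cu.1 = a%:~R -> w *+ b = cu.2 *~ a.
  case: cu => c u /=; have [a0 [b0 [nz0 e0]]] := prime_field_fraction c.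
  have [w hw] := div _ nz0 (u *~ a0); exists w => a b nz e.
  apply: (inj _ nz0); rewrite /= mulrnAC hw !pmulrn -!mulrzA.
  apply/eqP; rewrite -subr_eq0 -mulrzBr; apply/eqP/killz.
  by rewrite !(intrB, intrM) -e -e0 -!pmulrn mulrAC [X in _ - X]mulrAC
    (mulrC b%:R) subrr.
have [s0 hs] := choice ex; pose s c u := s0 (c, u).
have {}hs c u (a : int) (b : nat) :
    b%:R != 0 :> P -> b%:R * c = a%:~R -> s c u *+ b = u *~ a.
  exact: (hs (c, u)).
have sA a b v : s a (s b v) = s (a * b) v.
  have [a1 [a2 [nza ea]]] := prime_field_fraction a.
  have [b1 [b2 [nzb eb]]] := prime_field_fraction b.
  have nz : (a2 * b2)%:R != 0 :> P by rewrite natrM mulf_neq0.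
  apply: (inj _ nz); rewrite /= (hs (a * b) v (a1 * b1) _ nz); last first.
    by rewrite natrM mulrACA ea eb intrM.
  by rewrite mulrnA (hs _ _ _ _ nza ea) pmulrn mulrzAC -pmulrn
    (hs _ _ _ _ nzb eb) mulrzAC mulrzA.
have s1 : left_id 1 s.
  move=> v; have := hs 1 v 1 1%N; rewrite !mulr1n mulr1z oner_eq0.
  by apply; rewrite // mulr1.
have sDr : right_distributive s +%R.
  move=> a u v; have [a1 [a2 [nza ea]]] := prime_field_fraction a.
  by apply: (inj _ nza); rewrite /= mulrnDl !(hs _ _ _ _ nza ea) mulrzDl.
have sDl v : {morph s^~ v : a b / a + b}.
  move=> a b; have [a1 [a2 [nza ea]]] := prime_field_fraction a.
  have [b1 [b2 [nzb eb]]] := prime_field_fraction b.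
  have nz : (a2 * b2)%:R != 0 :> P by rewrite natrM mulf_neq0.
  apply: (inj _ nz); rewrite /= (hs (a + b) v (a1 * b2%:Z + b1 * a2%:Z) _ nz); last first.
    rewrite natrM intrD !intrM -ea -eb -!pmulrn mulrDr; congr (_ + _).
      by rewrite mulrAC.
    by rewrite -mulrA mulrC.
  rewrite mulrnDl {1}mulrnA (hs _ _ _ _ nza ea) mulnC mulrnA.
  by rewrite (hs _ _ _ _ nzb eb) !pmulrn -!mulrzA mulrzDr.
exact: scaling_lmod sA s1 sDr sDl.
Qed.

End PrimeField.

Lemma Fp_lmod p (M : zmodType) : prime p -> (forall u : M, u *+ p = 0) ->
  exists (N : lmodType 'F_p) (phi : M -> N),
    [/\ injective phi, forall v, exists u, phi u = v
      & {morph phi : u v / u + v}].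
Proof.
move=> pp pM; have chp := pchar_Fp pp.
have kill b : (p %| b)%N -> forall u : M, u *+ b = 0.
  by move=> /dvdnP[k ->] u; rewrite mulnC mulrnA pM mul0rn.
(* A Bezout coefficient serves as inverse of [b] modulo [p]. *)
have inv b : b%:R != 0 :> 'F_p -> exists c, forall u : M, u *+ (b * c) = u.
  rewrite -(dvdn_pcharf chp) => nb; have b0 : (0 < b)%N by case: b nb; rewrite ?dvdn0.
  have cop : coprime b p by rewrite coprime_sym prime_coprime.
  case: (egcdnP p b0) => c k e _; exists c => u.
  by rewrite mulnC e (eqP cop) mulrnDr (kill _ (dvdn_mull _ (dvdnn _))) add0r.
apply: prime_field_lmod; first exact: prime_field_Fp.
- by move=> b /eqP; rewrite -(dvdn_pcharf chp) => /kill.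
- by move=> b /inv [c cE] v; exists (v *+ c); rewrite -mulrnA mulnC.
- move=> b /inv [c cE] u v /= e.
  by rewrite -(cE u) -(cE v) !mulrnA e.
Qed.

Lemma rat_lmod (M : zmodType) :
  (forall p, prime p -> forall v : M, exists u, u *+ p = v) ->
  (forall p, prime p -> forall u : M, u *+ p = 0 -> u = 0) ->
  exists (N : lmodType rat) (phi : M -> N),
    [/\ injective phi, forall v, exists u, phi u = v
      & {morph phi : u v / u + v}].
Proof.
move=> divp torp.
(* Strong induction on [b], splitting off the prime factor [pdiv b]. *)
have H b : (0 < b)%N -> (forall v : M, exists u, u *+ b = v) /\
    (forall u : M, u *+ b = 0 -> u = 0).
  have [k] := ubnP b; elim: k b => // k IH b bk b0.
  have [b1|b1] := leqP b 1.
    have -> : b = 1%N by apply/eqP; rewrite eqn_leq b1.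
    by split=> [v|u]; rewrite ?mulr1n //; exists v.
  have pp := pdiv_prime b1; have dv := pdiv_dvd b.
  have q0 : (0 < b %/ pdiv b)%N by rewrite divn_gt0 ?pdiv_gt0 // dvdn_leq.
  have qb : (b %/ pdiv b < k)%N.
    by rewrite ltnS in bk; apply: leq_trans bk; rewrite ltn_Pdiv // prime_gt1.
  have [qd qt] := IH _ qb q0.
  split=> [v|u]; rewrite -(divnK dv).
    have [u <-] := divp _ pp v; have [w <-] := qd u; exists w.
    by rewrite mulrnA.
  by rewrite mulrnA => /(torp _ pp) /qt.
have nz (b : nat) : b%:R != 0 :> rat -> (0 < b)%N by rewrite pnatr_eq0 lt0n.
apply: prime_field_lmod; first exact: prime_field_rat.
- by move=> b /eqP; rewrite pnatr_eq0 => /eqP-> u.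
- by move=> b /nz /H [].
- move=> b /nz /H [_ tor] u v /= e; apply/eqP; rewrite -subr_eq0; apply/eqP/tor.
  by rewrite mulrnBl e subrr.
Qed.

(** * Intervals whose blocks are vector spaces over a prime field *)

Section PrimeCharts.
Variables (S : signature) (dt : term S 'I_3) (A : algebra S).
Implicit Types (th de : congruence A) (o x y z : A).

Hint Resolve cong_refl : core.

Lemma chart_iso th de o (M N : zmodType) (pi : A -> M) (phi : M -> N) :
  injective phi -> (forall v, exists u, phi u = v) ->
  {morph phi : u v / u + v} -> chart dt th de o pi -> chart dt th de o (phi \o pi).
Proof.
move=> inj surj phiD c.
have phiB u v : phi (u - v) = phi u - phi v.
  by apply/eqP; rewrite eq_sym subr_eq -phiD subrK.
split=> [v|x y ox oy|x y z ox oy oz] /=.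
- have [u <-] := surj v; have [x ox <-] := chart_surj c u; by exists x.
- split=> [/inj /(chart_eq c ox oy) //|]; by move=> /(chart_eq c ox oy) ->.
- by rewrite (chart_affine c) // phiD phiB.
Qed.

Lemma chart_int th de o : heap dt th de ->
  exists (M : lmodType int) (pi : A -> M), chart dt th de o pi.
Proof.
move=> /chart_exists => /(_ o) [M [pi c]].
have [||||N [phi [inj surj phiD]]] := @scaling_lmod int M (fun a v => v *~ a).
- by move=> a b v; rewrite -mulrzA_C.
- by move=> v; rewrite mulr1z.
- by move=> a u v; rewrite mulrzDl.
- by move=> v a b; rewrite mulrzDr.
by exists N, (phi \o pi); apply: chart_iso.
Qed.

Lemma pp_divisible (p : nat) (M : lmodType int) (v : 'I_1 -> M) :
  pp 1%:M (p%:R%:M : 'M[int]_1) v <-> exists w, v ord0 = w *+ p.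
Proof.
have E w (j : 'I_1) : (\sum_i (1%:M : 'M[int]_1) i j *: v i =
    \sum_k (p%:R%:M : 'M[int]_1) k j *: w k) <-> v ord0 = w ord0 *+ p.
  by rewrite !big_ord1 !mxE (ord1 j) eqxx !mulr1n scale1r scaler_nat.
split=> [[w /(_ ord0) /E h]|[w h]]; first by exists (w ord0).
by exists (fun=> w) => j; apply/E.
Qed.

(** A matrix [B] without rows leaves no witnesses, so the condition is a homogeneous equation. *)
Lemma pp_torsion (p : nat) (M : lmodType int) (v : 'I_1 -> M) :
  pp (p%:R%:M : 'M[int]_1) (0 : 'M[int]_(0, 1)) v <-> v ord0 *+ p = 0.
Proof.
have E w (j : 'I_1) : (\sum_i (p%:R%:M : 'M[int]_1) i j *: v i =
    \sum_k (0 : 'M[int]_(0, 1)) k j *: w k) <-> v ord0 *+ p = 0.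
  by rewrite big_ord0 big_ord1 !mxE (ord1 j) eqxx mulr1n scaler_nat.
split=> [[w /(_ ord0) /E]//|h].
by exists (fun=> 0) => j; apply/E.
Qed.

Lemma chart_lift th de o (M : zmodType) (pi : A -> M) v :
  chart dt th de o pi -> exists2 x, th o x & pi x - pi o = v.
Proof.
move=> c; have [x ox e] := chart_surj c (v + pi o); exists x => //.
by rewrite e addrK.
Qed.

Definition vector_interval (P : fieldType) : Prop := exists th de,
  [/\ heap dt th de, exists x y, th x y /\ ~ de x y & has_charts dt P th de].

Lemma Fp_interval p th de : prime p -> heap dt th de ->
  (exists x y, th x y /\ ~ de x y) ->
  (forall o (M : lmodType int) (pi : A -> M), chart dt th de o pi ->
     forall v : M, v *+ p = 0) ->
  vector_interval 'F_p.
Proof.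
move=> pp H nt tor; exists th, de; split=> // o.
have [M [pi c]] := chart_int o H.
have [N [phi [inj surj phiD]]] := Fp_lmod pp (tor _ _ _ c).
exists N, (phi \o pi); exact: chart_iso.
Qed.

Section Cases.
Variables th de : congruence A.
Hypotheses (H : heap dt th de).

Let autZ := int_additive_is_linear.
Let chartsZ o := chart_int o H.

Lemma pp_rel1 l m (K : 'M[int]_(1, l)) (B : 'M[int]_(m, l)) o x y
    (M : lmodType int) (pi : A -> M) :
  chart dt th de o pi -> th o x -> th o y ->
  pp_rel dt th de K B x (fun=> x) (fun=> y) <-> pp K B (fun=> pi x - pi y).
Proof.
move=> c ox oy; split=> [h|h].
  exact: (pp_rel_chart H autZ h (cong_sym ox) c).
by apply: (pp_rel_base H autZ chartsZ ox); exists M, pi; split.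
Qed.

Lemma pp_rel1_de l m (K : 'M[int]_(1, l)) (B : 'M[int]_(m, l)) x y :
  de x y -> pp_rel dt th de K B x (fun=> x) (fun=> y).
Proof.
move=> xy; have [M [pi c]] := chartsZ x.
have txy : th x y by move: xy; apply/cong_leP/(heap_le H).
apply/(pp_rel1 _ _ c) => //; have -> : pi x = pi y by apply/(chart_eq c).
rewrite subrr; exact: pp0.
Qed.

(** The new lower bound [g] stays strictly below [th] because [v] is not divisible by [p], and [p]
    kills the new blocks because [p]-fold differences lie in [g]. *)
Lemma Fp_interval_quotient p o (M : lmodType int) (pi : A -> M) (v : M) :
  prime p -> chart dt th de o pi -> (forall w, v <> w *+ p) ->
  vector_interval 'F_p.
Proof.
move=> pp c nv.
have [g gE] := pp_congruence H autZ chartsZ 1%:M (p%:R%:M : 'M[int]_1).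
have gth : (g <= th)%O.
  by apply/cong_leP => x y /gE [? [? [_ _ /(_ ord0)]]].
have deg : (de <= g)%O by apply/cong_leP => x y /pp_rel1_de h; apply/gE.
have H' := heap_mono (lexx th) deg gth H.
have gP x y (M' : lmodType int) (pi' : A -> M') o' : chart dt th de o' pi' ->
    th o' x -> th o' y -> g x y <-> exists w, pi' x - pi' y = w *+ p.
  move=> c' ox oy; rewrite gE (pp_rel1 _ _ c') //; exact: pp_divisible.
apply: Fp_interval pp (H') _ _.
  have [x ox e] := chart_lift v c; exists x, o; split; first exact: cong_sym.
  by move=> /(gP _ _ _ _ _ c ox (cong_refl _ _)) [w]; rewrite e; apply: nv.
move=> o' N rho cN m.
have [M' [pi' c']] := chartsZ o'.
have [L LE] := chart_factor autZ H (lexx th) deg (cong_refl _ _) c' cN.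
have [x ox <-] := chart_lift m cN; rewrite LE // -raddfMn.
(* In the old chart [z] represents [p] times the difference of [x] and [o'], hence is congruent to
   [o'] modulo [g]. *)
have [z oz e] := chart_lift ((pi' x - pi' o') *+ p) c'.
rewrite -e /= -LE //; apply/eqP; rewrite subr_eq0; apply/eqP/(chart_eq cN) => //.
by apply/(gP _ _ _ _ _ c') => //; exists (pi' x - pi' o').
Qed.

Lemma Fp_interval_torsion p o (M : lmodType int) (pi : A -> M) (v : M) :
  prime p -> chart dt th de o pi -> v *+ p = 0 -> v <> 0 ->
  vector_interval 'F_p.
Proof.
move=> pp c vp v0.
have [g gE] := pp_congruence H autZ chartsZ (p%:R%:M : 'M[int]_1)
  (0 : 'M[int]_(0, 1)).
have gth : (g <= th)%O.
  by apply/cong_leP => x y /gE [? [? [_ _ /(_ ord0)]]].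
have deg : (de <= g)%O by apply/cong_leP => x y /pp_rel1_de h; apply/gE.
have H' := heap_mono gth (lexx de) deg H.
have gP x y (M' : lmodType int) (pi' : A -> M') o' : chart dt th de o' pi' ->
    th o' x -> th o' y -> g x y <-> (pi' x - pi' y) *+ p = 0.
  move=> c' ox oy; rewrite gE (pp_rel1 _ _ c') //; exact: pp_torsion.
apply: Fp_interval pp (H') _ _.
  have [x ox e] := chart_lift v c; exists x, o; split.
    by apply/(gP _ _ _ _ _ c) => //; rewrite e.
  by move=> /(chart_eq c ox (cong_refl _ _)) e'; apply: v0; rewrite -e e' subrr.
move=> o' N rho cN m.
have [M' [pi' c']] := chartsZ o'.
have [L LE] := chart_factor autZ H' gth (lexx de) (cong_refl _ _) cN c'.
(* The lower bound [de] has not changed, so the smaller block embeds in the old one, and [p]-torsion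
   can be checked there. *)
have Linj u : L u = 0 -> u = 0.
  have [x gx <-] := chart_lift u cN; rewrite -LE // => /eqP.
  have ox : th o' x by move: gx; apply/cong_leP.
  rewrite subr_eq0 => /eqP /(chart_eq c' ox (cong_refl _ _)).
  by move=> /(chart_eq cN gx (cong_refl _ _)) ->; rewrite subrr.
apply: Linj; have [x gx <-] := chart_lift m cN; rewrite raddfMn /= -LE //.
apply/(gP _ _ _ _ _ c') => //; first by move: gx; apply/cong_leP.
exact: cong_sym.
Qed.

Lemma vector_interval_exists : (exists x y, th x y /\ ~ de x y) ->
  exists P : fieldType, prime_field P /\ vector_interval P.
Proof.
move=> nt.
have [[p [pp [o [M [pi [v [c nv]]]]]]]|nA] := pselect (exists p, prime p /\
    exists o (M : lmodType int) (pi : A -> M) (v : M),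
    chart dt th de o pi /\ forall w, v <> w *+ p).
  by exists 'F_p; split; [exact: prime_field_Fp|apply: Fp_interval_quotient pp c nv].
have [[p [pp [o [M [pi [v [c vp v0]]]]]]]|nB] := pselect (exists p, prime p /\
    exists o (M : lmodType int) (pi : A -> M) (v : M),
    [/\ chart dt th de o pi, v *+ p = 0 & v <> 0]).
  by exists 'F_p; split; [exact: prime_field_Fp|apply: Fp_interval_torsion pp c vp v0].
exists rat; split; first exact: prime_field_rat.
exists th, de; split=> // o; have [M [pi c]] := chartsZ o.
have [||N [phi [inj surj phiD]]] := @rat_lmod M.
- move=> p pp v; apply: contrapT => nv; apply: nA; exists p; split=> //.
  by exists o, M, pi, v; split=> // w e; apply: nv; exists w.
- move=> p pp v vp; apply: contrapT => v0; apply: nB; exists p; split=> //.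
  by exists o, M, pi, v.
by exists N, (phi \o pi); apply: chart_iso.
Qed.

End Cases.

End PrimeCharts.

(** * Embedding subspace lattices *)

Section MatrixAction.
Variables (P : fieldType) (M : lmodType P).

(** The product of a row vector with entries in [M] by a matrix of scalars. *)
Definition mxact m n (A : 'M[P]_(m, n)) (w : 'I_m -> M) : 'I_n -> M :=
  fun j => \sum_k A k j *: w k.

Lemma mxact_mul m n p (A : 'M_(m, n)) (B : 'M_(n, p)) w :
  mxact (A *m B) w = mxact B (mxact A w).
Proof.
apply/funext => j; rewrite /mxact.
under eq_bigr do rewrite mxE scaler_suml.
rewrite exchange_big /=; apply: eq_bigr => i _; rewrite scaler_sumr.
by apply: eq_bigr => k _; rewrite scalerA mulrC.
Qed.

Lemma mxactD m n (A B : 'M_(m, n)) w j :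
  mxact (A + B) w j = mxact A w j + mxact B w j.
Proof.
by rewrite /mxact -big_split /=; apply: eq_bigr => k _; rewrite mxE scalerDl.
Qed.

Lemma mxact0 m n w : mxact (0 : 'M_(m, n)) w = fun=> 0.
Proof. by apply/funext => j; rewrite /mxact big1 // => k _; rewrite mxE scale0r. Qed.

Lemma mxact_0 m n (A : 'M_(m, n)) : mxact A (fun=> 0) = fun=> 0.
Proof. by apply/funext => j; rewrite /mxact big1 // => k _; rewrite scaler0. Qed.

Lemma mxact1 n w : mxact (1%:M : 'M_n) w = w.
Proof.
apply/funext => j; rewrite /mxact (bigD1 j) //= mxE eqxx scale1r big1 ?addr0 //.
by move=> k /negPf kj; rewrite mxE kj scale0r.
Qed.

(** Membership in the tensor product of the row space of [A] with [M], seen inside [M ^ n]. *)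
Definition in_span m n (A : 'M_(m, n)) (v : 'I_n -> M) : Prop :=
  exists w, v = mxact A w.

Lemma pp_in_span m n (A : 'M_(m, n)) v : pp 1%:M A v <-> in_span A v.
Proof.
have E j : \sum_i (1%:M : 'M_n) i j *: v i = v j.
  exact: (congr1 (fun f => f j) (mxact1 v)).
split=> [[w h]|[w h]]; exists w; first by apply/funext => j; rewrite -E; apply: h.
by move=> j; rewrite E h.
Qed.

Lemma in_span_sub m1 m2 n (A : 'M_(m1, n)) (B : 'M_(m2, n)) v :
  (A <= B)%MS -> in_span A v -> in_span B v.
Proof. by move=> /submxP[D ->] [w ->]; exists (mxact D w); rewrite mxact_mul. Qed.

Lemma in_span_coker m n (A : 'M_(m, n)) v :
  in_span A v -> mxact (cokermx A) v = fun=> 0.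
Proof. by case=> w ->; rewrite -mxact_mul mulmx_coker mxact0. Qed.

(* [1 - X X^-] projects onto the kernel of [X], for [X^-] a generalized inverse;
   applied to [X] the juxtaposed cokernels of [A] and [B]. *)
Lemma in_span_cap m1 m2 n (A : 'M_(m1, n)) (B : 'M_(m2, n)) v :
  in_span A v -> in_span B v -> in_span (A :&: B)%MS v.
Proof.
move=> /in_span_coker vA /in_span_coker vB.
pose X := row_mx (cokermx A) (cokermx B); pose Z := 1%:M - X *m pinvmx X.
have vX : mxact X v = fun=> 0.
  apply/funext => j; rewrite -(splitK j); case: (split j) => i /=.
    rewrite -[RHS](congr1 (fun f => f i) vA).
    by apply: eq_bigr => k _; rewrite row_mxEl.
  rewrite -[RHS](congr1 (fun f => f i) vB).
  by apply: eq_bigr => k _; rewrite row_mxEr.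
have ZX : Z *m X = 0 by rewrite mulmxBl mul1mx mulmxKpV // subrr.
have vZ : v = mxact Z v.
  apply/funext => j; rewrite -[LHS](congr1 (fun f => f j) (mxact1 v)).
  rewrite -(subrK (X *m pinvmx X) 1%:M) mxactD.
  by rewrite (mxact_mul X) vX mxact_0 addr0.
apply: (@in_span_sub _ _ _ Z); last by exists v.
move: ZX; rewrite mul_mx_row => /eqP; rewrite row_mx_eq0 => /andP[ZA ZB].
by rewrite sub_capmx !submxE ZA.
Qed.

Lemma in_span_adds m1 m2 n (A : 'M_(m1, n)) (B : 'M_(m2, n)) v :
  in_span (A + B)%MS v ->
  exists v1 v2, [/\ in_span A v1, in_span B v2 & forall j, v j = v1 j + v2 j].
Proof.
case=> w ->; have /sub_addsmxP[[D D'] /= E] := submx_refl (A + B)%MS.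
exists (mxact (D *m A) w), (mxact (D' *m B) w); split=> [||j].
- by exists (mxact D w); rewrite mxact_mul.
- by exists (mxact D' w); rewrite mxact_mul.
- by rewrite {1}E mxactD.
Qed.

Lemma in_span_inj m1 m2 n (A : 'M_(m1, n)) (B : 'M_(m2, n)) (u : M) :
  u != 0 -> (forall v, in_span A v -> in_span B v) -> (A <= B)%MS.
Proof.
move=> u0 AB; rewrite submxE; apply/eqP/matrixP => i j.
(* With this [e], [mxact A e] is row [i] of [A] times [u]; as [u] is not 0, the cokernel of [B]
   kills it only if it kills the row. *)
pose e k : M := if k == i then u else 0.
have /AB/in_span_coker h : in_span A (mxact A e) by exists e.
have := congr1 (fun f => f j) h; rewrite -mxact_mul /mxact (bigD1 i) //= /e eqxx.
rewrite big1 ?addr0; last by move=> k /negPf ->; rewrite scaler0.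
by move/eqP; rewrite scaler_eq0 (negPf u0) orbF => /eqP ->; rewrite mxE.
Qed.

End MatrixAction.

(** * The algebra of tuples lying in one block *)

Section BlockPower.
Variables (S : signature) (A : algebra S) (th : congruence A) (I : Type).

(** The coordinate [None] marks the block and serves as base point; subspaces will constrain only
    the other coordinates. *)
Definition block_tuple := {x : option I -> A | forall i, th (x None) (x i)}.

Lemma block_tuple_interp (o : S) (u : 'I_(arity o) -> block_tuple) i :
  th (interp (fun s => sval (u s) None)) (interp (fun s => sval (u s) i)).
Proof. by apply: cong_compat => s; apply: svalP (u s) i. Qed.

Lemma block_tuple_inhabited : inhabited block_tuple.
Proof.
case: (carrier_inhabited A) => a; constructor; exists (fun=> a) => i.
exact: cong_refl.
Qed.

Definition block_power : algebra S := @Algebra S block_tuple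
  (fun o u => exist _ (fun i => interp (fun s => sval (u s) i))
                (block_tuple_interp u))
  block_tuple_inhabited.

Lemma eval_block_power X (v : X -> block_power) t i :
  sval (eval v t) i = eval (fun k => sval (v k) i) t.
Proof. by elim: t => //= o ts IH; congr interp; apply/funext. Qed.

Lemma block_power_variety (V : algebra S -> Prop) :
  variety V -> V A -> V block_power.
Proof.
move=> [E VE] /VE AE; apply/VE => s t /AE st v.
have e : sval (eval v s) = sval (eval v t).
  by apply/funext => i; rewrite !eval_block_power.
by case: (eval v s) (eval v t) e => x px [y py] /= e; apply: eq_exist.
Qed.

End BlockPower.

Section Embedding.
Variables (S : signature) (dt : term S 'I_3) (A : algebra S).
Variables (th de : congruence A) (P : fieldType).
Hypotheses (H : heap dt th de) (autP : additive_is_linear P).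
Hypothesis charts : has_charts dt P th de.

Hint Resolve cong_refl : core.

Section Power.
Variable n : nat.
Let C := block_power th 'I_n.
Implicit Types (U : 'M[P]_n) (x y z : C).

(** The second clause does not mention the base point of [y]; the first puts it in the block of [x],
    also when [n] is 0. *)
Definition mx_rel U x y : Prop := th (sval x None) (sval y None) /\
  pp_rel dt th de 1%:M U (sval x None) (sval x \o Some) (sval y \o Some).

Lemma mx_rel_equiv U : Equivalence (mx_rel U).
Proof.
split=> [x|x y [txy xy]|x y z [txy xy] [tyz yz]].
- by split=> //; apply: pp_rel_refl => // i; apply: (svalP x).
- split; first exact: cong_sym.
  exact/pp_rel_sym/(pp_rel_base H autP charts txy).
- split; first exact: cong_trans txy tyz.
  apply: (pp_rel_trans H autP xy).
  exact: (pp_rel_base H autP charts (cong_sym txy)).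
Qed.

Lemma mx_rel_compat U (o : S) (u v : 'I_(arity o) -> C) :
  (forall i, mx_rel U (u i) (v i)) -> mx_rel U (interp u) (interp v).
Proof.
move=> uv; split; first by apply: cong_compat => s; case: (uv s).
apply: (pp_rel_interp H autP charts (o := fun s => sval (u s) None)
  (x := fun s => sval (u s) \o Some) (y := fun s => sval (v s) \o Some)) => s.
by case: (uv s).
Qed.

Definition mx_cong U : congruence C :=
  Congruence (mx_rel_equiv U) (@mx_rel_compat U).

Lemma mx_congP U x y o (M : lmodType P) (pi : A -> M) : chart dt th de o pi ->
  th o (sval x None) -> th o (sval y None) -> mx_cong U x y <->
  in_span U (fun i => pi (sval x (Some i)) - pi (sval y (Some i))).
Proof.
move=> c ox oy; split=> [[_ h]|h].
  exact/pp_in_span/(pp_rel_chart H autP h (cong_sym ox) c).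
split; first exact: cong_trans (cong_sym ox) oy.
apply: (pp_rel_base H autP charts ox); exists M, pi; split=> // [i|i|].
- exact: cong_trans ox (svalP x _).
- exact: cong_trans oy (svalP y _).
- exact/pp_in_span.
Qed.

Lemma mx_cong_th U x y : mx_cong U x y -> th (sval x None) (sval y None).
Proof. by case. Qed.

Lemma mx_cong_sub U U' x y : (U <= U')%MS -> mx_cong U x y -> mx_cong U' x y.
Proof.
move=> s h; have [M [pi c]] := charts (sval x None); have t := mx_cong_th h.
apply/(mx_congP _ c) => //; apply: in_span_sub s _; exact/(mx_congP _ c).
Qed.

Lemma mx_cong_cap U U' x y :
  mx_cong U x y -> mx_cong U' x y -> mx_cong (U :&: U')%MS x y.
Proof.
move=> h h'; have [M [pi c]] := charts (sval x None); have t := mx_cong_th h.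
by apply/(mx_congP _ c) => //; apply: in_span_cap; apply/(mx_congP _ c).
Qed.

Lemma block_tuple_lift o (M : lmodType P) (pi : A -> M) (v : 'I_n -> M) :
  chart dt th de o pi ->
  exists x : C, sval x None = o /\ forall i, pi (sval x (Some i)) = v i.
Proof.
move=> c; have h i : exists a, th o a /\ pi a = v i.
  by have [a] := chart_surj c (v i); exists a.
have [a ha] := choice h.
have oa i : th o (oapp a o i) by case: i => [i|] //=; have [] := ha i.
by exists (exist _ (oapp a o) oa); split=> // i /=; have [] := ha i.
Qed.

(** The middle tuple [z] is [y] shifted by the summand lying in the span of [U']. Joins thus become
    relational products. *)
Lemma mx_cong_adds U U' x y : mx_cong (U + U')%MS x y ->
  exists z, mx_cong U x z /\ mx_cong U' z y.
Proof.
move=> h; have [M [pi c]] := charts (sval x None); have t := mx_cong_th h.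
have /in_span_adds[v1 [v2 [s1 s2 e]]] : in_span (U + U')%MS
    (fun i => pi (sval x (Some i)) - pi (sval y (Some i))).
  exact/(mx_congP _ c).
have [z [z0 zE]] := block_tuple_lift (fun i => v2 i + pi (sval y (Some i))) c.
exists z; split; apply/(mx_congP _ c); rewrite ?z0 //.
  have -> // : (fun i => pi (sval x (Some i)) - pi (sval z (Some i))) = v1.
  apply/funext => i; rewrite zE opprD addrCA addrC.
  by rewrite e -addrA subrr addr0.
have -> // : (fun i => pi (sval z (Some i)) - pi (sval y (Some i))) = v2.
by apply/funext => i; rewrite zE addrK.
Qed.

(** Every vector of [M ^ n] is the difference of two tuples in the block of [o], so the inclusion
    passes to spans. The nonzero vector [pi a - pi o] then allows [in_span_inj] to recover the row
    spaces. *)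
Lemma mx_cong_inj U U' o a : th o a -> ~ de o a ->
  (forall x y, mx_cong U x y -> mx_cong U' x y) -> (U <= U')%MS.
Proof.
move=> oa noa UU; have [M [pi c]] := charts o.
have u0 : pi a - pi o != 0.
  apply/eqP => /eqP; rewrite subr_eq0 => /eqP /(chart_eq c oa (cong_refl _ _)).
  by move=> /cong_sym.
apply: (in_span_inj u0) => v sv.
have [x [x0 xE]] := block_tuple_lift (fun i => v i + pi o) c.
have [y [y0 yE]] := block_tuple_lift (fun=> pi o) c.
have e : (fun i => pi (sval x (Some i)) - pi (sval y (Some i))) = v.
  by apply/funext => i; rewrite xE yE addrK.
rewrite -e; apply/(mx_congP _ c); rewrite ?x0 ?y0 //.
by apply/UU/(mx_congP _ c); rewrite ?x0 ?y0 // e.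
Qed.

End Power.

Import passmx.

Lemma vspace_in_SCon (V : algebra S -> Prop) (W : vectType P) :
  variety V -> V A -> (exists o a, th o a /\ ~ de o a) ->
  in_SCon V {vspace W}.
Proof.
move=> vV VA [o [a [oa noa]]].
pose C := block_power th 'I_(\dim (fullv : {vspace W})).
exists C; first exact: block_power_variety.
have eB : basis_of fullv (vbasis (fullv : {vspace W})) by apply: vbasisP.
(* Coordinates in a basis of [W] turn subspaces into row spaces of square matrices. *)
pose ms (U : {vspace W}) := msof (vbasis fullv) U.
have msE (U U' : {vspace W}) : (ms U <= ms U')%MS = (U <= U')%O.
  exact: sub_msof.
pose f (U : {vspace W}) : congruence C := mx_cong (ms U).
have f_mono : {homo f : U U' / (U <= U')%O}.
  by move=> U U' UU; apply/cong_leP => x y; apply: mx_cong_sub; rewrite msE.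
have fI : Order.meet_morphism f.
  move=> U U'; apply/le_anti; rewrite lexI !f_mono ?leIl ?leIr //=.
  apply/cong_leP => x y /meetE[h h'].
  by apply: mx_cong_sub (mx_cong_cap h h'); rewrite -vsof_sub // subv_cap
    !vsof_sub // capmxSl capmxSr.
have fU : Order.join_morphism f.
  move=> U U'; apply/le_anti; rewrite leUx !f_mono ?leUl ?leUr ?andbT //.
  apply/cong_leP => x y h.
  have /mx_cong_adds[z [xz zy]] : mx_cong (ms U + ms U')%MS x y.
    by apply: mx_cong_sub h; rewrite msof_sub // subv_add -!msof_sub // addsmxSl
      addsmxSr.
  apply: (cong_trans (y := z)).
    exact: (cong_leP _ _ (leUl (f U) (f U'))).
  exact: (cong_leP _ _ (leUr (f U') (f U))).
pose G : {omorphism {vspace W} -> congruence C} := HB.pack f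
  (Order.isOrderMorphism.Build _ _ _ _ f f_mono).
pose F : {lmorphism {vspace W} -> congruence C} := HB.pack f G
  (Order.isLatticeMorphism.Build _ _ _ _ G fI fU).
exists F => U U' e.
have fe : f U = f U' by [].
by apply/le_anti/andP; split; rewrite -msE; apply: (mx_cong_inj oa noa) => x y;
  rewrite -/(f U) -/(f U') fe.
Qed.

End Embedding.

Theorem theorem6p1 (S : signature) (V : algebra S -> Prop) :
  variety V ->
  has_weak_difference_term V ->
  ~ congruence_meet_semidistributive V ->
  exists P : fieldType, prime_field P /\
    forall (n : nat) (W : vectType P), \dim (fullv : {vspace W}) = n ->
      in_SCon V {vspace W}.
Proof.
move=> vV [dt wdt] /existsNP[A /not_implyP[VA]].
move=> /not_meet_semidistributive[th [de [le ne C]]].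
have H := abelian_heap le C (wdt A VA).
have nt : exists x y, th x y /\ ~ de x y.
  apply: contrapT => h; move/negP: ne; apply; apply/eqP/le_anti; rewrite le /=.
  apply/cong_leP => x y xy; apply: contrapT => nxy.
  by apply: h; exists x, y.
have [P [primeP [th' [de' [H' nt' charts]]]]] := vector_interval_exists H nt.
exists P; split=> // n W _.
exact: (vspace_in_SCon H' (prime_field_additive_is_linear primeP) charts).
Qed.
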